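(* Almost all graphs have conflict-free connection number $2$; that is, the proportion of graphs on $n$ labeled vertices $G$ with $cfc(G)=2$ among all graphs on these $n$ labeled vertices tends to $1$ as $n\to\infty$.
   Context: For a connected graph $G$ with an edge-coloring (adjacent edges may share colors), a path is conflict-free if some color appears on exactly one of its edges; the coloring is a conflict-free connection coloring if every two distinct vertices are joined by a conflict-free path. The conflict-free connection number $cfc(G)$ is the minimum number of colors in such a coloring. *)

(* Defs.v *)
From HB Require Import structures.
From mathcomp Require Import all_boot all_order all_algebra.
From mathcomp Require Import all_classical all_reals all_analysis.

Set Implicit Arguments.
Unset Strict Implicit.
Unset Printing Implicit Defensive.

Import Order.TTheory GRing.Theory Num.Theory.
Import numFieldNormedType.Exports.

Local Open Scope nat_scope.

Record sgraph (T : finType) := SGraph {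
  edges :> {set {set T}};
  edges_card2 : [forall e in edges, #|e| == 2]
}.

HB.instance Definition _ (T : finType) := [isSub for @edges T].
HB.instance Definition _ (T : finType) := [Finite of sgraph T by <:].

Section ConflictFreeConnection.
Variable T : finType.
Implicit Types (G : sgraph T) (c : {set T} -> nat) (x y : T) (p : seq T).

(* Irreflexive because [set x; x] has cardinal 1. *)
Definition adj G : rel T := fun x y => [set x; y] \in edges G.

Definition graph_connected G : bool := [forall x, forall y, connect (adj G) x y].

(* The vertex sequence x :: p is a path (without repeated vertices). *)
Definition is_path G x p y : bool :=
  [&& path (adj G) x p, uniq (x :: p) & last x p == y].

Definition path_edges x p : seq {set T} :=
  pairmap (fun u v => [set u; v]) x p.

Definition conflict_free c x p : Prop :=
  exists i : nat, count (fun e => c e == i) (path_edges x p) = 1.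

Definition cf_connection_coloring G c : Prop :=
  forall x y, x != y -> exists2 p, is_path G x p y & conflict_free c x p.

(* Colors are natural numbers; only the values of c on edges matter. *)
Definition cf_colorable G (k : nat) : Prop :=
  exists2 c, (forall e, e \in edges G -> c e < k) & cf_connection_coloring G c.

Lemma connected_cf_colorable G :
  graph_connected G -> exists k, `[< cf_colorable G k >].
Proof.
move=> /forallP cG; exists #|{set T}|; apply/asboolP.
exists (fun e => enum_rank e : nat) => [e _|x y neq_xy]; first exact: ltn_ord.
case/forallP/(_ y)/connectP: (cG x) neq_xy => p0 p0P ->.
case/shortenP: p0P => -[|z p] /= pP pU _ neq; first by rewrite eqxx in neq.
exists (z :: p); first by rewrite /is_path /= pP pU eqxx.
exists (enum_rank [set x; z] : nat); rewrite /= eqxx.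
apply/eqP; rewrite -[1]addn0 eqn_add2l -leqn0 leqNgt -has_count -all_predC.
apply/allP => e ep /=; apply/eqP => /ord_inj/enum_rank_inj eE; subst e.
have: x \in [set x; z] by rewrite !inE eqxx.
move: pU; rewrite /= => /andP[+ _]; move: ep; move: [set x; z] => e.
elim: p z {pP neq} => [|w p IHp] z //=.
rewrite /path_edges /= in_cons => /orP[/eqP->|ep].
  by rewrite !inE !negb_or => /and3P[/negPf-> /negPf->].
by rewrite inE negb_or => /andP[_]; apply: IHp ep.
Qed.

Definition cfc G (cG : graph_connected G) : nat := ex_minn (connected_cf_colorable cG).

End ConflictFreeConnection.

(* cfc is only defined on connected graphs, so cfc(G) = 2 includes
   connectedness of G. *)
Definition cfc2_graphs (n : nat) : {set sgraph 'I_n} :=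
  [set G | `[< exists cG : graph_connected G, cfc cG = 2 >]].

(* Main.v *)
(** Color each edge by the parity of the sum of its two endpoints. On a path
    [x - 2k - 2k+1 - y] the colors are [odd x], [1] and [1 (+) odd y], so the
    path is conflict-free unless [x] is odd and [y] is even; in that case a path
    [y - 2k - 2k+1 - x] does the job. For fixed [x] and [y] these paths are
    edge-disjoint for different [k], so a random graph contains none of them
    with probability at most [(7/8)^(n/2-2)], and the union bound over the pairs
    [(x, y)] leaves a proportion [O(1/n)] of graphs in which this coloring
    fails. One color suffices only for the complete graph. *)
Require Import Defs.
From mathcomp Require Import all_boot all_order all_algebra.
From mathcomp Require Import all_classical all_reals all_analysis.
From mathcomp Require Import zify.

Import Order.TTheory GRing.Theory Num.Theory.
Import numFieldNormedType.Exports.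

Lemma expn_homo (e : nat) : {homo expn^~ e : m n / (m <= n)%N}.
Proof. by case: e => [|e] m n; rewrite ?expn0 ?leq_exp2r. Qed.

(** * Subsets of a finite set that include none of several disjoint small sets *)

Section AvoidingDisjointSets.
Import fintype mathcomp.boot.finset.
Local Open Scope nat_scope.
Variable T : finType.
Implicit Types (E t S : {set T}) (F : {set {set T}}).

(** The map sending [S] to the pair of [S :|: t] and [S :&: t] is injective; its second component
    takes at most [2 ^ k] values. *)
Lemma card_supersets_ge F t k : #|t| <= k ->
  (forall S, S \in F -> S :|: t \in F) ->
  #|F| <= #|[set S in F | t \subset S]| * 2 ^ k.
Proof.
move=> tk FU.
pose f S := (S :|: t, S :&: t).
have finj : {in F &, injective f}.
  move=> S1 S2 _ _ [eU eI]; apply/setP => z.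
  move/setP: eU => /(_ z); move/setP: eI => /(_ z); rewrite !inE.
  by case: (z \in t); rewrite ?andbT ?orbF.
rewrite -(card_in_imset finj).
apply: (@leq_trans #|setX [set S in F | t \subset S] (powerset t)|).
  apply/subset_leq_card/subsetP => _ /imsetP[S SF ->].
  by rewrite !inE /= FU // subsetUr subsetIr.
by rewrite cardsX card_powerset leq_mul2l leq_exp2l // tk orbT.
Qed.

(** Inequality form of independence: a uniform random subset of [E] misses part of each [t] with
    probability at most [1 - 2 ^ -k], and disjointness lets these bounds multiply. *)
Lemma card_avoiding E (s : seq {set T}) k :
  all (fun t => (t \subset E) && (#|t| <= k)) s ->
  pairwise (fun t1 t2 => [disjoint t1 & t2]) s ->
  #|[set S in powerset E | all (fun t => ~~ (t \subset S)) s]| * (2 ^ k) ^ size s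
    <= 2 ^ #|E| * (2 ^ k).-1 ^ size s.
Proof.
elim: s => [|t s IHs] /=.
  move=> _ _; rewrite !expn0 !muln1 -card_powerset; apply/subset_leq_card.
  by apply/subsetP => S; rewrite inE => /andP[].
move=> /andP[/andP[tE tk] sE] /andP[tD sD].
pose F : {set {set T}} :=
  [set S in powerset E | all (fun u : {set T} => ~~ (u \subset S)) s].
have {IHs} : #|F| * (2 ^ k) ^ size s <= _ := IHs sE sD => IHs.
(* Adding [t] cannot complete any [u] of the tail, since [u] is disjoint from [t]. *)
have FU S : S \in F -> S :|: t \in F.
  rewrite !inE => /andP[SE /allP Ss]; rewrite subUset SE tE /=.
  apply/allP => u us; apply: contra (Ss u us) => /subsetP uSt.
  apply/subsetP => z zu; move: (uSt z zu); rewrite inE => /orP[//|zt].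
  have /disjointFr /(_ zt) := allP tD u us.
  by rewrite zu.
have le1 := card_supersets_ge _ _ _ tk FU.
have -> : [set S in powerset E | ~~ (t \subset S) &&
      all (fun u : {set T} => ~~ (u \subset S)) s]
    = F :\: [set S in F | t \subset S].
  apply/setP => S; rewrite !inE.
  by case: (S \subset E); case: (t \subset S) => //=; case: all.
pose A := [set S in F | t \subset S]; rewrite -/A in le1 *.
have AF : A \subset F by apply/subsetP => S; rewrite inE => /andP[].
have cF := cardsID A F; rewrite (setIidPr AF) in cF.
have le2 : #|F :\: A| * 2 ^ k <= #|F| * (2 ^ k).-1.
  have := expn_gt0 2 k; move: (2 ^ k) le1 => K; nia.
rewrite !expnS mulnA (leq_trans (leq_mul le2 (leqnn _))) //.
rewrite mulnAC [leqRHS]mulnCA [leqRHS]mulnC.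
by rewrite leq_mul2r IHs orbT.
Qed.

End AvoidingDisjointSets.

(** * Counting graphs by edge sets, and colorings with at most one color *)

Section SmallNumberOfColors.
Import fintype mathcomp.boot.finset.
Local Open Scope nat_scope.
Variable T : finType.
Implicit Types G : sgraph T.

Definition all_edges : {set {set T}} := [set e : {set T} | #|e| == 2].

Lemma edges_sub G : edges G \subset all_edges.
Proof.
by apply/subsetP => e eG; rewrite inE; have /forall_inP := edges_card2 G; apply.
Qed.

Lemma card_sgraph_set (P : pred {set {set T}}) :
  #|[set G : sgraph T | P (edges G)]| = #|[set S in powerset all_edges | P S]|.
Proof.
have vinj : injective (@edges T) := val_inj.
rewrite -(card_imset _ vinj); apply: eq_card => S; apply/imsetP/idP.
  by move=> [G GP ->]; rewrite inE in GP; rewrite !inE edges_sub GP.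
rewrite !inE => /andP[/subsetP SE PS].
have S2 : [forall e in S, #|e| == 2].
  by apply/forall_inP => e /SE; rewrite inE.
by exists (SGraph S2); rewrite ?inE.
Qed.

Lemma card_sgraph : #|{: sgraph T}| = 2 ^ 'C(#|T|, 2).
Proof.
rewrite -[LHS]cardsT -card_draws -/(all_edges) -card_powerset.
transitivity #|[set G : sgraph T | xpredT (edges G)]|.
  by apply: eq_card => G; rewrite !inE.
by rewrite (card_sgraph_set xpredT); apply: eq_card => S; rewrite !inE andbT.
Qed.

Lemma cf_colorable_connected G k : cf_colorable G k -> graph_connected G.
Proof.
move=> [c _ cP]; apply/forallP => x; apply/forallP => y.
have [->|/cP[p /and3P[pP _ /eqP <-] _]] := eqVneq x y; first exact: connect0.
by apply/connectP; exists p.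
Qed.

Lemma path_edges_sub G x p e :
  path (adj G) x p -> e \in path_edges x p -> e \in edges G.
Proof.
elim: p x => [//|y p IHp] x /= /andP[xy yp].
by rewrite inE => /orP[/eqP->//|]; apply: IHp.
Qed.

Lemma cf_colorable1_adj G k x y :
  cf_colorable G k -> k <= 1 -> x != y -> adj G x y.
Proof.
move=> [c ck cP] k1 xy; have [p /and3P[pP _ /eqP py] [i ci]] := cP x y xy.
have c0 e : e \in path_edges x p -> c e = 0.
  by move=> ep; have := ck e (path_edges_sub _ _ _ _ pP ep); lia.
(* All edges have color 0, so a color that occurs exactly once forces a path of length 1. *)
have : count (fun e => c e == i) (path_edges x p) = (0 == i) * size p.
  rewrite -(size_pairmap (fun u v => [set u; v]) x p) -/(path_edges x p).
  rewrite (@eq_in_count _ _ (fun=> 0 == i)); last by move=> e /c0 ->.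
  by case: eqP; rewrite ?count_predT ?count_pred0 ?mul1n ?mul0n.
rewrite ci; case: eqP => _; rewrite ?mul0n // mul1n => s1.
case: p s1 pP py {ci c0} => [|z [|//]] //= _.
by rewrite andbT => + <-.
Qed.

Lemma cfc_eq2 G : cf_colorable G 2 -> edges G != all_edges ->
  exists cG : graph_connected G, cfc cG = 2.
Proof.
move=> G2 GN; exists (cf_colorable_connected _ _ G2).
rewrite /cfc; case: ex_minnP => k /asboolP kP kmin.
have k2 : k <= 2 by apply/kmin/asboolP.
have [k1|] := leqP k 1; last by move=> ?; apply/eqP; rewrite eqn_leq k2.
case/negP: GN; rewrite eqEsubset edges_sub; apply/subsetP => e.
by rewrite inE => /cards2P[x [y [xy ->]]]; exact: cf_colorable1_adj kP k1 xy.
Qed.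

End SmallNumberOfColors.

(** * The parity coloring and the links of length 3 *)

Section ParityColoring.
Import fintype mathcomp.boot.finset.
Local Open Scope nat_scope.

Definition parity_coloring n (e : {set 'I_n}) : nat := odd (\sum_(i in e) i).

Lemma parity_coloring2 n (x y : 'I_n) : x != y ->
  parity_coloring n [set x; y] = odd x (+) odd y.
Proof.
by move=> xy; rewrite /parity_coloring big_setU1 ?inE //= big_set1 oddD.
Qed.

Variable m : nat.
Let V := 'I_m.+1.
Implicit Types (x y : V) (k : nat).

(** [inord] falls back to vertex 0 out of range; the indices in [link_indices] satisfy
    [k.*2.+1 <= m], so this never happens for them. *)
Let ev k : V := inord k.*2.
Let od k : V := inord k.*2.+1.

Definition link x y k : {set {set V}} :=
  [set [set x; ev k]; [set ev k; od k]; [set od k; y]].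

Definition link_indices x y : seq nat :=
  [seq k <- iota 0 m.+1./2 | (k != x./2) && (k != y./2)].

Lemma link_vertices {x y k} : k \in link_indices x y ->
  [/\ ev k = k.*2 :> nat, od k = k.*2.+1 :> nat, k != x./2 & k != y./2].
Proof.
rewrite mem_filter mem_iota /= add0n => /andP[/andP[kx ky] kn].
by split=> //; apply: inordK; lia.
Qed.

Lemma size_link_indices x y : m.+1./2 - 2 <= size (link_indices x y).
Proof.
rewrite size_filter; set P := (P in count P _).
have := count_predC P (iota 0 m.+1./2); rewrite size_iota.
have : count (predC P) (iota 0 m.+1./2) <= 2.
  rewrite (@eq_count _ _ (predU (pred1 (x./2)) (pred1 (y./2)))); last first.
    by move=> k; rewrite /= negb_and !negbK.
  have := count_predUI (pred1 (x./2)) (pred1 (y./2)) (iota 0 m.+1./2).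
  rewrite !count_uniq_mem ?iota_uniq //; lia.
move: (count P _) (count (predC P) _); lia.
Qed.

Lemma link_uniq x y k : x != y -> k \in link_indices x y ->
  uniq [:: x; ev k; od k; y].
Proof.
move=> xy /link_vertices[ek ok kx ky].
rewrite /= !inE -!val_eqE /= ek ok; move: xy; rewrite -val_eqE /=; lia.
Qed.

Lemma link_sub x y k : x != y -> k \in link_indices x y ->
  link x y k \subset all_edges V.
Proof.
move=> xy /(link_uniq _ _ _ xy); rewrite /= !inE !negb_or.
move=> /and4P[/and3P[xe xo _] /andP[eo ey] oy _].
apply/subsetP => e; rewrite !inE => /orP[/orP[]|] /eqP ->.
- by rewrite cards2 xe.
- by rewrite cards2 eo.
- by rewrite cards2 oy.
Qed.

Lemma card_link x y k : #|link x y k| <= 3.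
Proof. by rewrite /link -setUA cardsU1 cards2; case: (_ \notin _); case: (_ != _). Qed.

(** Each edge of the link at [k] has an endpoint with half [k], while the vertices of the link at
    [l] have halves [l], [x./2] and [y./2], all different from [k]. *)
Lemma disjoint_link x y k l : k \in link_indices x y ->
  l \in link_indices x y -> k != l -> [disjoint link x y k & link x y l].
Proof.
move=> /link_vertices[ek ok kx ky] /link_vertices[el ol lx ly] kl.
rewrite -setI_eq0; apply/eqP/setP => e; rewrite in_setI in_set0.
apply/negbTE/negP => /andP[eK eL].
have [v ve vk] : exists2 v : V, v \in e & v./2 = k.
  move: eK; rewrite !inE => /orP[/orP[]|] /eqP ->.
  - by exists (ev k); rewrite ?inE ?eqxx ?orbT // ek; lia.
  - by exists (ev k); rewrite ?inE ?eqxx ?orbT // ek; lia.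
  - by exists (od k); rewrite ?inE ?eqxx ?orbT // ok; lia.
have : v \in [set x; y; ev l; od l].
  move: eL ve; rewrite !inE => /orP[/orP[]|] /eqP ->; rewrite !inE;
  by case/orP => ->; rewrite ?orbT.
rewrite !inE -!val_eqE /= el ol; lia.
Qed.

Definition unlinked x y : {set sgraph V} :=
  [set G : sgraph V | all (fun t : {set {set V}} => ~~ (t \subset edges G))
                          [seq link x y k | k <- link_indices x y]].

Lemma card_unlinked x y : x != y ->
  #|unlinked x y| * 8 ^ (m.+1./2 - 2) <= #|{: sgraph V}| * 7 ^ (m.+1./2 - 2).
Proof.
move=> xy; set s := [seq link x y k | k <- link_indices x y].
have sE : all (fun t : {set {set V}} => (t \subset all_edges V) && (#|t| <= 3)) s.
  apply/allP => _ /mapP[k kI ->].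
  by rewrite link_sub // card_link.
have sD : pairwise (fun t1 t2 : {set {set V}} => [disjoint t1 & t2]) s.
  rewrite pairwise_map.
  have : uniq (link_indices x y) by rewrite filter_uniq ?iota_uniq.
  rewrite uniq_pairwise; apply: (@sub_in_pairwise _ (mem (link_indices x y))).
    by move=> k l kI lI; apply: disjoint_link.
  exact/allP.
have := card_avoiding _ _ _ _ sE sD.
rewrite /unlinked (card_sgraph_set _
  (fun S => all (fun t : {set {set V}} => ~~ (t \subset S)) s)).
rewrite card_sgraph -card_draws size_map.
set N := #|_|; have := size_link_indices x y.
move: (size _) (_ - 2) => a b /subnKC <-; rewrite !expnD !mulnA.
change (2 ^ 3) with 8; change 8.-1 with 7 => le.
(* There may be more links than the guaranteed [b]; the surplus is discarded by
   [7 ^ (a - b) <= 8 ^ (a - b)]. *)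
rewrite -(leq_pmul2r (_ : 0 < 8 ^ (a - b))) ?expn_gt0 //.
by apply: leq_trans le _; rewrite leq_mul2l expn_homo ?orbT.
Qed.

Lemma linked_colorable2 (G : sgraph V) :
  (forall x y, x != y -> G \notin unlinked x y) -> cf_colorable G 2.
Proof.
move=> GL; exists (parity_coloring m.+1) => [e _|x y xy].
  by rewrite /parity_coloring; case: odd.
have {}GL u v : u != v -> exists2 k, uniq [:: u; ev k; od k; v] /\
    odd (ev k) = false /\ odd (od k)
    & [/\ adj G u (ev k), adj G (ev k) (od k) & adj G (od k) v].
  move=> uv; have := GL u v uv; rewrite inE => /allPn[_ /mapP[k kI ->]].
  rewrite negbK => /subsetP kG; exists k.
    have [-> -> _ _] := link_vertices kI.
    by rewrite (link_uniq _ _ _ uv kI) /= odd_double.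
  by split; apply: kG; rewrite !inE eqxx ?orbT.
(* A link from [x] to [y] would have colors 1, 1, 1 here; a link from [y] to [x], traversed
   backwards, has colors 0, 1, 0. *)
have [/andP[ox oy]|oxy] := boolP (odd x && ~~ odd y).
  have [|k [kU [oe oo]] [ye eo ox']] := GL y x; first by rewrite eq_sym.
  move: kU; rewrite -rev_uniq /= !inE !negb_or.
  move=> /and4P[/and3P[xo xe xy'] /andP[oe' oy'] ey _].
  exists [:: od k; ev k; y].
    rewrite /is_path /= !inE !negb_or xo xe xy oe' oy' ey eqxx /=.
    rewrite /adj [[set x; _]]setUC [[set od k; ev k]]setUC [[set ev k; y]]setUC.
    by rewrite -!/(adj _ _ _) ye eo ox'.
  exists 1; rewrite /path_edges /= !parity_coloring2 // oe oo ox.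
  by move: oy; case: odd.
have [k [kU [oe oo]] [xe eo oy]] := GL x y xy.
move: (kU); rewrite /= !inE !negb_or.
move=> /and4P[/and3P[xe' xo' _] /andP[eo' ey'] oy' _].
exists [:: ev k; od k; y]; first by rewrite /is_path [uniq _]kU /= xe eo oy eqxx.
(* The colors are 0, 1, 1 or 0, 1, 0 or 1, 1, 0 when the parities of [x] and [y] are 0, 0 or 0, 1 or
   1, 1; the color occurring once is their sum modulo 2. *)
exists (odd x (+) odd y : nat).
rewrite /path_edges /= !parity_coloring2 // oe oo.
by move: oxy; do 2 case: odd.
Qed.

End ParityColoring.

(** * The union bound and its rate of decay *)

Section Counting.
Import fintype mathcomp.boot.finset.
Local Open Scope nat_scope.

Lemma succ_mul_expn7_le j : j.+1 * 7 ^ j <= 7 * 8 ^ j.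
Proof.
elim: j => // j IHj; have : 7 ^ j <= 8 ^ j by rewrite expn_homo.
rewrite !expnS; nia.
Qed.

(* The exponent 3 makes the decay of [(7/8)^m] beat the [n^2] terms of the union
   bound with a factor [n] to spare. *)
Lemma cube_mul_expn7_le m : (m %/ 3).+1 ^ 3 * 7 ^ m <= 7 ^ 3 * 8 ^ m.
Proof.
rewrite {2 3}(divn_eq m 3) !expnD !mulnA leq_mul //; last by rewrite expn_homo.
by rewrite !expnM -!expnMn expn_homo // succ_mul_expn7_le.
Qed.

Lemma card_not_cfc2 : exists K, forall n, 1 < n ->
  #|~: cfc2_graphs n| * n <= K * #|{: sgraph 'I_n}|.
Proof.
(* The product pays for the union bound [B], the successor for the complete graph. *)
exists (9 ^ 3 * 7 ^ 3).+1 => -[//|m] m_gt0; set N := #|{: _}|.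
pose B := \sum_(p : 'I_m.+1 * 'I_m.+1 | p.1 != p.2) #|unlinked m p.1 p.2|.
have leB : #|~: cfc2_graphs m.+1| <= B + 1.
  pose W := \bigcup_(p : 'I_m.+1 * 'I_m.+1 | p.1 != p.2) unlinked m p.1 p.2.
  pose C := [set G : sgraph 'I_m.+1 | edges G == all_edges _].
  apply: (@leq_trans #|W :|: C|).
    apply/subset_leq_card/subsetP => G; rewrite !inE; apply: contraNT.
    rewrite negb_or => /andP[GW GC]; apply/asboolP/cfc_eq2 => //.
    apply: linked_colorable2 => x y xy; apply: contra GW => Gxy.
    by apply/bigcupP; exists (x, y).
  apply: (leq_trans (leq_card_setU _ _)); apply: leq_add.
    rewrite /W /B; elim/big_rec2: _ => [|p k A _ le]; first by rewrite cards0.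
    by rewrite (leq_trans (leq_card_setU _ _)) // leq_add2l.
  apply/card_le1_eqP => G H; rewrite !inE => /eqP GE /eqP HE.
  by apply: val_inj; rewrite /= GE HE.
have BN : B * 8 ^ (m.+1./2 - 2) <= m.+1 ^ 2 * N * 7 ^ (m.+1./2 - 2).
  (* There are at most [m.+1 ^ 2] ordered pairs, each with the same bound. *)
  rewrite /B big_distrl /=.
  apply: (@leq_trans (\sum_(p : 'I_m.+1 * 'I_m.+1 | p.1 != p.2)
                        N * 7 ^ (m.+1./2 - 2))).
    by apply: leq_sum => p pP; exact: card_unlinked.
  rewrite sum_nat_const -mulnA leq_mul2r; apply/orP; right.
  by apply: (leq_trans (max_card _)); rewrite card_prod card_ord.
have nN : m.+1 <= N.
  rewrite /N card_sgraph card_ord bin2 /=.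
  apply: (leq_trans (ltn_expl m (isT : 1 < 2))).
  by rewrite leq_exp2l // geq_half_double; nia.
have := cube_mul_expn7_le (m.+1./2 - 2).
(* With [p] the successor of the quotient, [m.+1 <= 6 * p + 3], and [p] is positive. *)
have : m.+1 <= 9 * ((m.+1./2 - 2) %/ 3).+1 by lia.
move: (m.+1./2 - 2) BN => q BN; move: (q %/ 3).+1 => p np pq.
have pB : p ^ 3 * B <= 7 ^ 3 * (m.+1 ^ 2 * N).
  rewrite -(@leq_pmul2r (8 ^ q)) ?expn_gt0 // -mulnA.
  apply: leq_trans (leq_mul (leqnn _) BN) _.
  by rewrite mulnCA [leqRHS]mulnAC [leqRHS]mulnC leq_mul.
(* Replace [p ^ 3] using [m.+1 ^ 3 <= 9 ^ 3 * p ^ 3] and cancel [m.+1 ^ 2]; one factor [m.+1]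
   survives. *)
have nB : m.+1 * B <= 9 ^ 3 * 7 ^ 3 * N.
  rewrite -(@leq_pmul2l (m.+1 ^ 2)) ?expn_gt0 // mulnA -expnSr.
  apply: leq_trans (leq_mul (expn_homo 3 _ _ np) (leqnn B)) _.
  by rewrite expnMn -mulnA [leqRHS]mulnCA -[leqRHS]mulnA leq_mul2l pB orbT.
apply: leq_trans (leq_mul leB (leqnn _)) _.
by rewrite mulnDl mul1n mulSn addnC leq_add // mulnC.
Qed.

End Counting.

(** * Passage to the limit *)

Local Open Scope classical_set_scope.
Local Open Scope ring_scope.

Theorem theorem1p5 (R : realType) :
  (fun n : nat =>
     #|cfc2_graphs n|%:R / #|{: sgraph 'I_n}|%:R : R) @ \oo --> (1 : R).
Proof.
have [K cK] := card_not_cfc2.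
(* The shift by 2 secures at least two vertices. The bound [K / n.+2] on the failing proportion is
   weakened to [K / n.+1] to match the harmonic sequence. *)
rewrite -(@cvg_shiftn 2 R); apply: (@squeeze_cvgr _ _ _ _
  (fun n => 1 - K%:R * (n.+1%:R)^-1) (cst 1)); last exact: cvg_cst.
  near=> n; rewrite /= addn2.
  have := cK n.+2 isT.
  have := cardsC (cfc2_graphs n.+2).
  have : (0 < #|{: sgraph 'I_n.+2}|)%N by rewrite card_sgraph expn_gt0.
  move: #|cfc2_graphs n.+2| #|~: cfc2_graphs n.+2| #|{: sgraph 'I_n.+2}|
    => a b N N0 abN bN.
  have N0' : (0 : R) < N%:R by rewrite ltr0n.
  apply/andP; split; last by rewrite ler_pdivrMr // mul1r ler_nat -abN leq_addr.
  rewrite ler_pdivlMr // mulrBl mul1r lerBlDr -{1}abN natrD lerD2l mulrAC.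
  rewrite ler_pdivlMr ?ltr0n // -!natrM ler_nat (leq_trans _ bN) //.
  by rewrite leq_mul2l leqnSn orbT.
rewrite -[X in _ --> X]subr0 -[X in _ - X](mulr0 K%:R).
by apply: cvgB; [exact: cvg_cst|apply: cvgMr; exact: cvg_harmonic].
Unshelve. all: by end_near.
Qed.
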